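(* Let $n$ be a positive integer, $m=2^n+1$, and let $X=\mathbb{Z}_2[t,t^{-1}]/(\xi_m(t))$, regarded as an Alexander quandle, where $\xi_m(t)=\sum_{i=0}^{m-1}(-t)^i$. Then the $4$-dimensional quandle cohomology group of $X$ with coefficients in (the additive group of) $X$ is non-trivial: $H^4_{\rm Q}(X;X)\neq 0$.
   Context: $\mathbb{Z}_2=\mathbb{Z}/2\mathbb{Z}$. A quandle is a set $X$ with a binary operation $*$ such that $a*a=a$; for all $a,b$ there is a unique $c$ with $a=c*b$; and $(a*b)*c=(a*c)*(b*c)$. Any $\mathbb{Z}[t,t^{-1}]$-module $M$ is a quandle (Alexander quandle) under $a*b=ta+(1-t)b$. Quandle cohomology: for a quandle $X$ let $C_n^R(X)$ be the free abelian group on $X^n$, with boundary $$\partial_n(x_1,\ldots,x_n)=\sum_{i=2}^n(-1)^i\big[(x_1,\ldots,x_{i-1},x_{i+1},\ldots,x_n)-(x_1*x_i,\ldots,x_{i-1}*x_i,x_{i+1},\ldots,x_n)\big]$$ for $n\ge 2$ and $\partial_n=0$ for $n\le 1$. Let $C_n^D(X)\subset C_n^R(X)$ be the subgroup generated by tuples with $x_i=x_{i+1}$ for some $i\in\{1,\ldots,n-1\}$ if $n\geq 2$, and $C_n^D(X)=0$ otherwise; it is a subcomplex. Set $C_n^Q(X)=C_n^R(X)/C_n^D(X)$ with the induced boundary. For an abelian group $A$, $C_Q^n(X;A)=\mathrm{Hom}(C_n^Q(X),A)$ with coboundary $\delta f=f\circ\partial$, and $H^n_{\rm Q}(X;A)$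 is the $n$-th cohomology group of this cochain complex. *)

(* Defs.v *)
From HB Require Import structures.
From mathcomp Require Import all_boot all_algebra.
From mathcomp Require Import generic_quotient ring_quotient fraction.
From mathcomp Require Import boolp.
From mathcomp.multinomials Require Import freeg.

Set Implicit Arguments.
Unset Strict Implicit.
Unset Printing Implicit Defensive.

Import GRing.Theory.

Local Open Scope ring_scope.
Local Open Scope quotient_scope.

Record quandle := Quandle {
  quandle_sort :> choiceType;
  qop : quandle_sort -> quandle_sort -> quandle_sort;
  qop_idem : forall a, qop a a = a;
  qop_div : forall a b, exists! c, a = qop c b;
  qop_dist : forall a b c, qop (qop a b) c = qop (qop a c) (qop b c)
}.

Section Alexander.

(* A module over a commutative ring R with a marked unit t is a Z[t,t^-1]-module
   through Z[t,t^-1] -> R; the case R = Z[t,t^-1] gives all of them. *)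
Variables (R : comPzRingType) (t : R) (M : lmodType R).
Hypothesis t_unit : exists u, u * t = 1.

Definition alexander_op (a b : M) : M := t *: a + (1 - t) *: b.

Fact alexander_idem a : alexander_op a a = a.
Proof. by rewrite /alexander_op -scalerDl addrC subrK scale1r. Qed.

Fact alexander_div a b : exists! c, a = alexander_op c b.
Proof.
case: t_unit => u ut; exists (u *: (a - (1 - t) *: b)); split.
  by rewrite /alexander_op scalerA mulrC ut scale1r subrK.
by move=> c ->; rewrite /alexander_op addrK scalerA ut scale1r.
Qed.

Fact alexander_dist a b c :
  alexander_op (alexander_op a b) c =
  alexander_op (alexander_op a c) (alexander_op b c).
Proof.
rewrite /alexander_op !scalerDr !scalerA [(1 - t) * t]mulrC -!addrA.
congr (_ + _); rewrite [RHS]addrCA; congr (_ + _).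
by rewrite -scalerDl -mulrDl [t + _]addrC subrK mul1r.
Qed.

Definition alexander : quandle :=
  Quandle alexander_idem alexander_div alexander_dist.

End Alexander.

Section GeneratedSubgroup.
Variables (V : zmodType) (G : V -> Prop).

Definition subgroup_gen : {pred V} := fun v =>
  `[< forall S : {pred V}, zmod_closed S -> (forall g, G g -> g \in S) ->
      v \in S >].

Lemma subgroup_genP v :
  reflect (forall S : {pred V}, zmod_closed S ->
             (forall g, G g -> g \in S) -> v \in S)
          (v \in subgroup_gen).
Proof. exact: asboolP. Qed.

Fact subgroup_gen_closed : zmod_closed subgroup_gen.
Proof.
split=> [|u v /subgroup_genP Gu /subgroup_genP Gv]; apply/subgroup_genP => S S_cl GS.
  by case: S_cl.
by case: (S_cl) => _; apply; [apply: Gu | apply: Gv].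
Qed.

HB.instance Definition _ :=
  GRing.isZmodClosed.Build V subgroup_gen subgroup_gen_closed.

Lemma mem_subgroup_gen v : G v -> v \in subgroup_gen.
Proof. by move=> Gv; apply/subgroup_genP => S _; apply. Qed.

End GeneratedSubgroup.

Section Hom.
Variables U V : zmodType.

Definition hom : Type := {additive U -> V}.

HB.instance Definition _ := gen_eqMixin hom.
HB.instance Definition _ := gen_choiceMixin hom.

Definition hom_fun (f : hom) : U -> V := (f : {additive U -> V}).
Coercion hom_fun : hom >-> Funclass.

HB.instance Definition _ (f : hom) :=
  GRing.isZmodMorphism.Build U V (hom_fun f) (raddfB (f : {additive U -> V})).

Lemma homP (f g : hom) : (f =1 g) <-> (f = g).
Proof.
split=> [|-> //]; case: f g => [f [[f_add]]] [g [[g_add]]] fg.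
have {}fg : f = g by apply: funext.
move: f_add g_add; rewrite fg => f_add g_add.
by rewrite (Prop_irrelevance f_add g_add).
Qed.

Let hom0 : hom := (\0 : U -> V) : {additive U -> V}.
Let homN (f : hom) : hom := (\- f) : {additive U -> V}.
Let homD (f g : hom) : hom := (f \+ g) : {additive U -> V}.

Fact homDA : associative homD.
Proof. by move=> f g h; apply/homP => x; apply: addrA. Qed.

Fact homDC : commutative homD.
Proof. by move=> f g; apply/homP => x; apply: addrC. Qed.

Fact hom0D : left_id hom0 homD.
Proof. by move=> f; apply/homP => x; apply: add0r. Qed.

Fact homND : left_inverse hom0 homN homD.
Proof. by move=> f; apply/homP => x; apply: addNr. Qed.

HB.instance Definition _ := GRing.isZmodule.Build hom homDA homDC hom0D homND.

Lemma hom0E x : (0 : hom) x = 0. Proof. by []. Qed.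
Lemma homNE (f : hom) x : (- f) x = - f x. Proof. by []. Qed.
Lemma homDE (f g : hom) x : (f + g) x = f x + g x. Proof. by []. Qed.

End Hom.

Section QuandleHomology.
Variable X : quandle.
Implicit Types n : nat.

Definition rchain n : zmodType := {freeg (n.-tuple X)}.

(* Tuples are indexed from 0: the usual sum over 2 <= i <= n with sign (-1)^i
   becomes a sum over 0 < i with sign (-1)^(i + 1).  [fintype.lift i] enumerates
   the indices other than i in increasing order. *)
Definition face n (x : n.+1.-tuple X) (i : 'I_n.+1) : n.-tuple X :=
  [tuple tnth x (fintype.lift i k) | k < n].

Definition face_op n (x : n.+1.-tuple X) (i : 'I_n.+1) : n.-tuple X :=
  [tuple if (k < i)%N then qop (tnth x (fintype.lift i k)) (tnth x i)
         else tnth x (fintype.lift i k) | k < n].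

Definition rboundary_tuple n (x : n.+1.-tuple X) : {freeg (n.-tuple X)} :=
  \sum_(i < n.+1 | (0 < i)%N)
     (-1) ^+ i.+1 *: (<< face x i >> - << face_op x i >>).

Definition rboundary n : rchain n.+1 -> rchain n := fglift (@rboundary_tuple n).

HB.instance Definition _ n :=
  GRing.isZmodMorphism.Build (rchain n.+1) (rchain n) (@rboundary n)
    (lift_is_additive (@rboundary_tuple n)).

Lemma rboundaryU n (x : n.+1.-tuple X) : rboundary << x >> = rboundary_tuple x.
Proof. by rewrite /rboundary liftU scale1r. Qed.

Definition degenerate n (x : n.-tuple X) : Prop :=
  exists i j : 'I_n, j = i.+1 :> nat /\ tnth x i = tnth x j.

Definition dchain n : {pred rchain n} :=
  subgroup_gen (fun c : rchain n => exists2 x, degenerate x & c = << x >>).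

Arguments dchain : clear implicits.

HB.instance Definition _ n := GRing.ZmodClosed.on (dchain n).

Lemma mem_dchain n (x : n.-tuple X) :
  degenerate x -> (<< x >> : rchain n) \in dchain n.
Proof. by move=> x_deg; apply: mem_subgroup_gen; exists x. Qed.

Lemma face_degenerate n (x : n.+1.-tuple X) (i j k : 'I_n.+1) :
    j = i.+1 :> nat -> tnth x i = tnth x j -> k != i -> k != j ->
  degenerate (face x k) /\ degenerate (face_op x k).
Proof.
move=> ij xij ki kj.
case: (unlift_some ki) => a ia _; case: (unlift_some kj) => b jb _.
have vi : i = bump k a :> nat by rewrite ia.
have vj : j = bump k b :> nat by rewrite jb.
have [ab akb] : b = a.+1 :> nat /\ (a < k)%N = (b < k)%N.
  move: vi vj; rewrite ij /bump => ->.
  case: (leqP k a) => ka; case: (leqP k b) => kb /=; rewrite ?add1n ?add0n.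
  - by case.
  - move=> bE; suff: (k < k)%N by rewrite ltnn.
    by apply: leq_ltn_trans kb; rewrite -bE (leq_trans ka) // -addn2 leq_addr.
  - case=> bE; suff: (k < k)%N by rewrite ltnn.
    by apply: leq_ltn_trans ka; rewrite bE.
  - by [].
by split; exists a, b; split => //; rewrite !tnth_mktuple -ia -jb ?akb xij //.
Qed.

Fact rboundary_tuple_degenerate n (x : n.+1.-tuple X) :
  degenerate x -> rboundary_tuple x \in dchain n.
Proof.
case=> i [j [ij xij]]; rewrite /rboundary_tuple.
have neq_ij : i != j by rewrite -val_eqE /= ij ltn_eqF.
have rest (k : 'I_n.+1) : k != i -> k != j ->
    (-1) ^+ k.+1 *: (<< face x k >> - << face_op x k >>) \in dchain n.
  move=> ki kj; have [dx dx'] := face_degenerate ij xij ki kj.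
  by rewrite rpredZsign rpredB //; apply: mem_dchain.
have lift_lt (k : 'I_n.+1) (a : 'I_n) : (a < k)%N -> fintype.lift k a = a :> nat.
  by move=> ak; rewrite /= /bump leqNgt ak.
have lift_ge (k : 'I_n.+1) (a : 'I_n) : (k <= a)%N -> fintype.lift k a = a.+1 :> nat.
  by move=> ak; rewrite /= /bump ak.
have face_ij : face x i = face x j.
  apply: eq_from_tnth => a; rewrite !tnth_mktuple.
  case: (ltngtP a i) => ai.
  - congr (tnth x _); apply: ord_inj.
    by rewrite (lift_lt i) // (lift_lt j) // ij (ltn_trans ai).
  - congr (tnth x _); apply: ord_inj.
    by rewrite (lift_ge i) ?(ltnW ai) // (lift_ge j) // ij.
  - have -> : fintype.lift i a = j by apply: ord_inj; rewrite (lift_ge i) ai ?ij.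
    by have -> : fintype.lift j a = i by apply: ord_inj; rewrite (lift_lt j) ?ai ?ij.
have face_op_j : (0 < i)%N -> face_op x i = face_op x j.
  move=> i_gt0; apply: eq_from_tnth => a; rewrite !tnth_mktuple xij.
  have /(congr1 (fun y => tnth y a)) := face_ij; rewrite !tnth_mktuple => faE.
  case: (ltngtP a i) => ai.
  - by rewrite ij (ltn_trans ai) // faE.
  - by rewrite ltnNge ij ai /= faE.
  - rewrite ij ai leqnn.
    have -> : fintype.lift i a = j by apply: ord_inj; rewrite (lift_ge i) ai ?ij.
    have -> : fintype.lift j a = i by apply: ord_inj; rewrite (lift_lt j) ?ai ?ij.
    by rewrite xij qop_idem.
have face_op_j0 : i = 0%N :> nat -> face_op x j = face x j.
  move=> i0; apply: eq_from_tnth => a; rewrite !tnth_mktuple ij i0.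
  case: ltnP => //; rewrite ltnS leqn0 => /eqP a0.
  have -> : fintype.lift j a = i.
    by apply: ord_inj; rewrite (lift_lt j) ?a0 ?i0 ?ij.
  by rewrite xij qop_idem.
rewrite (bigD1 j) /=; last by rewrite ij.
case: (posnP i) => i0.
  rewrite face_op_j0 // subrr scaler0 add0r.
  apply: rpred_sum => k /andP[k_gt0 kj]; apply: rest => //.
  by apply: contraTneq k_gt0 => ->; rewrite i0.
rewrite (bigD1 i) ?i0 //= addrA face_ij face_op_j // ij exprS mulN1r scaleNr addNr add0r.
by apply: rpred_sum => k /andP[/andP[_ kj] ki]; apply: rest.
Qed.

Fact rboundary_dchain n (c : rchain n.+1) :
  c \in dchain n.+1 -> rboundary c \in dchain n.
Proof.
move=> /subgroup_genP /(_ [pred c | rboundary c \in dchain n]); apply.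
  by split=> [|u v]; rewrite !inE ?raddf0 ?rpred0 // raddfB; apply: rpredB.
move=> _ [x x_deg ->]; rewrite inE rboundaryU.
exact: rboundary_tuple_degenerate.
Qed.

Definition qchain n : zmodType := {ideal_quot (dchain n)}.

Definition qboundary n (c : qchain n.+1) : qchain n :=
  \pi_(qchain n) (rboundary (repr c)).

Lemma qboundary_pi n (c : rchain n.+1) :
  qboundary (\pi_(qchain n.+1) c) = \pi_(qchain n) (rboundary c).
Proof.
apply/eqP; rewrite /qboundary -Quotient.idealrBE -raddfB.
by apply: rboundary_dchain; rewrite Quotient.idealrBE reprK.
Qed.

Fact qboundary_is_zmod_morphism n : zmod_morphism (@qboundary n).
Proof.
move=> c d; rewrite -[c]reprK -[d]reprK.
by rewrite -raddfB !qboundary_pi !raddfB.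
Qed.

HB.instance Definition _ n :=
  GRing.isZmodMorphism.Build (qchain n.+1) (qchain n) (@qboundary n)
    (@qboundary_is_zmod_morphism n).

End QuandleHomology.

Section QuandleCohomology.
Variables (X : quandle) (A : zmodType).
Implicit Types n : nat.

Definition cochain n : zmodType := hom (qchain X n) A.

Definition coboundary n (f : cochain n) : cochain n.+1 :=
  (f \o @qboundary X n) : {additive qchain X n.+1 -> A}.

Fact coboundary_is_zmod_morphism n : zmod_morphism (@coboundary n).
Proof. by move=> f g; apply/homP. Qed.

HB.instance Definition _ n :=
  GRing.isZmodMorphism.Build (cochain n) (cochain n.+1) (@coboundary n)
    (@coboundary_is_zmod_morphism n).

Lemma coboundaryE n (f : cochain n) c : coboundary f c = f (qboundary c).
Proof. by []. Qed.

Definition is_cocycle n : {pred cochain n} := fun f => coboundary f == 0.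

Fact is_cocycle_closed n : zmod_closed (@is_cocycle n).
Proof.
split=> [|f g]; rewrite !unfold_in /is_cocycle ?raddf0 //.
move=> /eqP f0 /eqP g0; apply/eqP.
by rewrite [LHS]coboundary_is_zmod_morphism f0 g0 subrr.
Qed.

HB.instance Definition _ n :=
  GRing.isZmodClosed.Build (cochain n) (@is_cocycle n) (@is_cocycle_closed n).

Record cocycle n := Cocycle {
  cocycle_val :> cochain n;
  _ : cocycle_val \in @is_cocycle n
}.

HB.instance Definition _ n := [isSub for @cocycle_val n].
HB.instance Definition _ n := [Choice of cocycle n by <:].
HB.instance Definition _ n := [SubChoice_isSubZmodule of cocycle n by <:].

(* In degree 0 the only coboundary is 0, as there are no cochains in degree -1. *)
Definition is_coboundary n : cochain n -> Prop :=
  match n with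
  | 0 => fun f => f = 0
  | k.+1 => fun f => exists g : cochain k, f = coboundary g
  end.

Definition coboundary_cocycle n : {pred cocycle n} :=
  fun z => `[< is_coboundary (cocycle_val z) >].

Fact coboundary_cocycle_closed n : zmod_closed (@coboundary_cocycle n).
Proof.
split=> [|u v /asboolP bu /asboolP bv]; apply/asboolP.
  have -> : cocycle_val (0 : cocycle n) = 0 by [].
  by case: n => [//|n]; exists 0; rewrite [RHS]raddf0.
have -> : cocycle_val (u - v) = cocycle_val u - cocycle_val v by [].
case: n u v bu bv => [|n] u v /=; first by move=> -> ->; rewrite subr0.
by move=> [f ->] [g ->]; exists (f - g); rewrite [RHS]raddfB.
Qed.

HB.instance Definition _ n :=
  GRing.isZmodClosed.Build (cocycle n) (@coboundary_cocycle n)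
    (@coboundary_cocycle_closed n).

Definition quandle_cohomology n : zmodType :=
  {ideal_quot (@coboundary_cocycle n)}.

End QuandleCohomology.

Section Laurent.
Variable R : idomainType.
Local Notation "p %:F" := (FracField.tofrac p).

(* R[t,t^-1], as the subring of R(t) of the fractions p / t^k. *)
Definition is_laurent : {pred {fraction {poly R}}} := fun x =>
  `[< exists (p : {poly R}) (k : nat), x = p%:F / 'X%:F ^+ k >].

Lemma is_laurentP x :
  reflect (exists (p : {poly R}) (k : nat), x = p%:F / 'X%:F ^+ k)
          (x \in is_laurent).
Proof. exact: asboolP. Qed.

Lemma fracX_neq0 : 'X%:F != 0 :> {fraction {poly R}}.
Proof. by rewrite tofrac_eq0 polyX_eq0. Qed.

Fact is_laurent_closed : subring_closed is_laurent.
Proof.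
have Xn_neq0 k : 'X%:F ^+ k != 0 :> {fraction {poly R}}.
  by rewrite expf_neq0 // fracX_neq0.
split=> [|x y|x y].
- by apply/is_laurentP; exists 1, 0%N; rewrite tofrac1 expr0 divr1.
- move=> /is_laurentP[p [k ->]] /is_laurentP[q [l ->]]; apply/is_laurentP.
  exists (p * 'X^l - q * 'X^k), (k + l)%N.
  rewrite -mulNr addf_div ?Xn_neq0 // exprD mulNr.
  by rewrite -!tofracXn -!tofracM -tofracB.
- move=> /is_laurentP[p [k ->]] /is_laurentP[q [l ->]]; apply/is_laurentP.
  exists (p * q), (k + l)%N.
  by rewrite mulf_div exprD tofracM.
Qed.

HB.instance Definition _ :=
  GRing.isSubringClosed.Build {fraction {poly R}} is_laurent is_laurent_closed.

Record laurent := Laurent {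
  laurent_val : {fraction {poly R}};
  _ : laurent_val \in is_laurent
}.

HB.instance Definition _ := [isSub for laurent_val].
HB.instance Definition _ := [Choice of laurent by <:].
HB.instance Definition _ := [SubChoice_isSubComNzRing of laurent by <:].

Fact laurentX_subproof : 'X%:F \in is_laurent.
Proof. by apply/is_laurentP; exists 'X, 0%N; rewrite expr0 divr1. Qed.

Fact laurentXV_subproof : 'X%:F^-1 \in is_laurent.
Proof. by apply/is_laurentP; exists 1, 1%N; rewrite tofrac1 expr1 mul1r. Qed.

Definition laurentX : laurent := Laurent laurentX_subproof.
Definition laurentXV : laurent := Laurent laurentXV_subproof.

Lemma laurentXVX : laurentXV * laurentX = 1.
Proof. by apply: val_inj; rewrite /= mulVf ?fracX_neq0. Qed.

End Laurent.

Section XiQuandle.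
Implicit Types n : nat.

Definition xi (m : nat) : laurent 'F_2 := \sum_(i < m) (- laurentX _) ^+ i.

(* Indexed by n rather than by m = 2^n + 1, because [xi m] generates a proper
   ideal only for m <> 1; n = 0 gives m = 2, so no hypothesis on n is needed. *)
Definition xi_ideal n : {pred laurent 'F_2} :=
  fun x => `[< exists q, x = q * xi (2 ^ n + 1)%N >].

Lemma xi_idealP n x :
  reflect (exists q, x = q * xi (2 ^ n + 1)%N) (x \in xi_ideal n).
Proof. exact: asboolP. Qed.

Lemma xi_val m :
  laurent_val (xi m) = FracField.tofrac (\poly_(i < m) (-1) ^+ i : {poly 'F_2}).
Proof.
rewrite poly_def raddf_sum -[LHS]/(\val (xi m)) raddf_sum.
apply: eq_bigr => i _; rewrite [LHS](rmorphXn (\val : {rmorphism laurent _ -> _})) raddfN.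
by rewrite -mul_polyC polyC_exp polyCN -exprMn mulN1r /= tofracXn tofracN.
Qed.

Fact xi_ideal_closed n : idealr_closed (xi_ideal n).
Proof.
split=> [||a x y /xi_idealP[p ->] /xi_idealP[q ->]]; first 1 last.
- apply/negP => /xi_idealP[q /(congr1 (@laurent_val _))].
  rewrite -[RHS]/(laurent_val q * laurent_val (xi _)) -[LHS]/1 xi_val.
  case: q => q /= /is_laurentP[p [k ->]].
  set s : {poly 'F_2} := \poly_(i < _) _ => E.
  have {}E : 'X^k = p * s.
    apply/eqP; rewrite -tofrac_eq tofracM tofracXn; apply/eqP.
    have Xk : FracField.tofrac 'X ^+ k != 0 :> {fraction {poly 'F_2}}.
      by rewrite expf_neq0 // fracX_neq0.
    by move: E; rewrite mulrAC => /esym/(canRL (divfK Xk)) ->; rewrite mul1r.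
  have size_s : size s = (2 ^ n + 1)%N.
    by rewrite size_poly_eq // addn1 /= expf_neq0 // oppr_eq0 oner_eq0.
  have s0 : s.[0] != 0.
    by rewrite horner_coef0 coef_poly addn1.
  have : coprimep s ('X^k).
    apply: coprimep_expr; rewrite -['X]subr0 -polyC0 coprimep_XsubC.
    exact: s0.
  have s_dvd : s %| 'X^k by rewrite E dvdp_mull.
  move=> /(coprimep_dvdl s_dvd).
  by rewrite coprimepp size_s addn1 eqSS expn_eq0.
- by apply/xi_idealP; exists (a * p + q); rewrite mulrDl mulrA.
- by apply/xi_idealP; exists 0; rewrite mul0r.
Qed.

HB.instance Definition _ n :=
  isIdealr.Build (laurent 'F_2) (xi_ideal n) (xi_ideal_closed n).

Definition xi_ring n : comNzRingType := {ideal_quot (xi_ideal n)}.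

Definition xi_t n : xi_ring n := \pi_(xi_ring n) (laurentX 'F_2).

Fact xi_t_unit n : exists u, u * xi_t n = 1.
Proof.
exists (\pi_(xi_ring n) (laurentXV 'F_2)).
by rewrite /xi_t -[LHS]rmorphM laurentXVX rmorph1.
Qed.

(* X is a module over itself, with t acting as multiplication by its class. *)
Definition xi_quandle n : quandle := alexander (xi_ring n)^o (xi_t_unit n).

End XiQuandle.

(* Main.v *)
Require Import Defs.
From HB Require Import structures.
From mathcomp Require Import all_boot all_algebra all_solvable all_field ring.
From mathcomp Require Import generic_quotient ring_quotient fraction boolp.
From mathcomp.multinomials Require Import freeg.
Import GRing.Theory.
Local Open Scope ring_scope.
Local Open Scope quotient_scope.

Set Implicit Arguments.
Unset Strict Implicit.
Unset Printing Implicit Defensive.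

(** Let K be the field with 2^(2n) elements, z in K a root of unity of exact
    order m = 2^n + 1, and a = 2^(n-1), so that 2a + 1 = m.

    Reduction to a field.  Sending t to z gives a Z[t,1/t]-linear map p : X -> K
    [xi_ring_eval].  It has the Z[t,1/t]-linear section
      s(v) = sum_(i < m) Tr(v z^-i) t^i
    [trace_section], Tr being the trace of K over the field with two elements:
    s is linear because t^m = 1, and p s = id because
      p(s(v)) = sum_(j < 2n) v^(2^j) sum_(i < m) z^(i (1 - 2^j)),
    where 2 has order 2n modulo m, so that only j = 0 contributes.  Hence K, as
    a quandle and as a coefficient group, is a retract of X, and a cocycle
    K^4 -> K that is not a coboundary pulls back to such a cocycle X^4 -> X
    [essential_cocycle_retract].

    The cocycle.  On K take F = (x1-x2)^a (x2-x3)^a (x3-x4)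
    [trilinear_cocycle].  Since a is a power of 2, F is additive in each of the
    differences u = x1-x2, v = x2-x3, w = x3-x4, and the cocycle identity is an
    identity of polynomials.

    It is not a coboundary.  Suppose F = d g and put x4 = 0.  With
    h(r,s) = g(r+s, s, 0) and G(u,v,w) = g(x1,x2,x3) this reads
      u^a v^a w = h(u+v, w) - h(zu+v, w) - h(u, v+w) + h(zu, zv+w)
                  + G(u,v,w) - G(zu,zv,zw).
    Sum both sides against u^-b v^-c w^-d with b + c + d = m [moment3].
    Rescaling the variables by z shows that the two G terms cancel, as z^m = 1,
    and the convolutions in the other terms become Jacobi sums
    J(b,c) = sum_u u^-b (1-u)^-c, so that the right-hand side is
      (1 - z^b) J(b,c) P(b+c, d) - (1 - z^(b+c)) J(c,d) P(b, c+d),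
    P(b,c) being the sum of h(u,v) against u^-b v^-c.  In characteristic 2,
    J(a,a) = 0 by partial fractions [jacobi_sum_diag].  When a <> 1 the
    left-hand side vanishes for (b,c,d) = (1,a,a) and (a,1,a), which gives
    J(a,1) P(a+1,a) = 0 and then J(a,1) P(a,a+1) = 0; when a = 1 these hold
    because J(1,1) = 0.  For (b,c,d) = (a,a,1) the right-hand side is then 0,
    but the left-hand side is (-1)^3. *)

(** * Cochains as functions on tuples *)

(** Since quandle chains form the quotient of a free group by degenerate tuples,
    a cochain is the same thing as a function on tuples that vanishes on the
    degenerate ones; this is the coboundary in those terms. *)
Definition tuple_coboundary (X : quandle) (A : zmodType) n
    (phi : n.-tuple X -> A) (x : n.+1.-tuple X) : A :=
  \sum_(i < n.+1 | (0 < i)%N)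
    (phi (face x i) - phi (face_op x i)) *~ (-1) ^+ i.+1.

Definition normalized (X : quandle) (A : zmodType) n (phi : n.-tuple X -> A) :=
  forall x, degenerate x -> phi x = 0.

Definition essential_cocycle (X : quandle) (A : zmodType) n
    (phi : n.+1.-tuple X -> A) :=
  [/\ normalized phi, forall x, tuple_coboundary phi x = 0 &
      forall psi : n.-tuple X -> A, normalized psi ->
        ~ (forall x, phi x = tuple_coboundary psi x)].

Section FunctionsAsCochains.
Variables (X : quandle) (A : zmodType).

Definition linear_extension n (phi : n.-tuple X -> A) : rchain X n -> A :=
  fglift (phi : n.-tuple X -> zmodule A).

HB.instance Definition _ n (phi : n.-tuple X -> A) :=
  GRing.isZmodMorphism.Build (rchain X n) A (linear_extension phi)
    (lift_is_additive (phi : n.-tuple X -> zmodule A)).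

Lemma linear_extensionU n (phi : n.-tuple X -> A) x :
  linear_extension phi << x >> = phi x.
Proof. by rewrite /linear_extension liftU scale1r. Qed.

Lemma linear_extension_boundary n (phi : n.-tuple X -> A) x :
  linear_extension phi (rboundary << x >>) = tuple_coboundary phi x.
Proof.
rewrite rboundaryU raddf_sum; apply: eq_bigr => i _.
have -> : (-1) ^+ i.+1 *: (<< face x i >> - << face_op x i >>)
   = (<< face x i >> - << face_op x i >>) *~ (-1) ^+ i.+1 :> rchain X n.
  by rewrite -signr_odd; case: (odd _); rewrite ?scaleN1r ?scale1r.
by rewrite raddfMz raddfB /= !linear_extensionU.
Qed.

Lemma rchain_ext n (f g : {additive rchain X n -> A}) :
  (forall x, f << x >> = g << x >>) -> f =1 g.
Proof.
move=> fg c; elim/freeg_ind_dom0: c => [|k x c _ _ IH].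
  by rewrite !raddf0.
by rewrite !raddfD IH -[k]intz -freegU_mulz !raddfMz fg.
Qed.

Lemma linear_extension_dchain n (phi : n.-tuple X -> A) (c : rchain X n) :
  normalized phi -> c \in dchain (n := n) -> linear_extension phi c = 0.
Proof.
move=> phi_norm /subgroup_genP /(_ [pred c | linear_extension phi c == 0]) H.
apply/eqP/H => [|_ [x x_deg ->]]; last first.
  by rewrite inE linear_extensionU phi_norm.
split=> [|u v]; rewrite !inE ?raddf0 // => /eqP u0 /eqP v0.
by rewrite raddfB /= u0 v0 subr0.
Qed.

Lemma cochain_exists n (phi : n.-tuple X -> A) : normalized phi ->
  exists f : cochain X A n,
    forall c, f (\pi_(qchain X n) c) = linear_extension phi c.
Proof.
move=> phi_norm; pose f (c : qchain X n) : A := linear_extension phi (repr c).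
have f_pi c : f (\pi_(qchain X n) c) = linear_extension phi c.
  apply/eqP; rewrite -subr_eq0 -raddfB; apply/eqP.
  by apply: linear_extension_dchain; rewrite // Quotient.idealrBE reprK.
have f_add : zmod_morphism f.
  by move=> c d; rewrite -[c]reprK -[d]reprK -raddfB !f_pi raddfB.
pose F := GRing.isZmodMorphism.Build _ _ f f_add.
pose g : {additive qchain X n -> A} := HB.pack f F.
by exists g.
Qed.

Lemma cochain_boundary n (f : cochain X A n) x :
  f (qboundary (\pi_(qchain X n.+1) << x >>)) =
  tuple_coboundary (fun y => f (\pi_(qchain X n) << y >>)) x.
Proof.
rewrite qboundary_pi -linear_extension_boundary; move: (rboundary _) => c.
pose g : {additive rchain X n -> A} := f \o \pi_(qchain X n).
rewrite -[LHS]/(g c); apply: rchain_ext => y.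
by rewrite /= linear_extensionU.
Qed.

(** Reduces the non-triviality of a quotient of a group of homomorphisms on a
    quotient to a statement about functions on tuples only. *)
Lemma cohomology_neq0 n (phi : n.+1.-tuple X -> A) :
  essential_cocycle phi -> exists h : quandle_cohomology X A n.+1, h != 0.
Proof.
case=> phi_norm phi_coc phi_ncob.
have [f f_pi] := cochain_exists phi_norm.
have f_coc : f \in @is_cocycle X A n.+1.
  apply/eqP/homP => c; rewrite -[c]reprK; move: (repr c) => {}c.
  pose g : {additive rchain X n.+2 -> A} :=
    (f : {additive _ -> _}) \o @qboundary X _ \o \pi_(qchain X n.+2).
  rewrite -[LHS]/(g c); apply: (@rchain_ext _ g \0) => x /=.
  by rewrite qboundary_pi f_pi linear_extension_boundary phi_coc.
exists (\pi_(quandle_cohomology X A n.+1) (Cocycle f_coc)).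
apply/eqP => h0.
have : Cocycle f_coc - 0 \in @coboundary_cocycle X A n.+1.
  by rewrite Quotient.idealrBE raddf0; apply/eqP.
rewrite subr0 => /asboolP [g /= fg].
apply: (phi_ncob (fun y => g (\pi_(qchain X n) << y >>))) => [y y_deg|x].
  suff -> : \pi_(qchain X n) << y >> = 0 by rewrite raddf0.
  rewrite -[RHS](raddf0 \pi_(qchain X n)); apply/eqP.
  by rewrite -Quotient.idealrBE subr0; apply: mem_dchain.
by rewrite -cochain_boundary -coboundaryE -fg f_pi linear_extensionU.
Qed.

End FunctionsAsCochains.

(** * Retracts of quandles *)

Definition quandle_hom (X Y : quandle) (r : X -> Y) :=
  forall a b, r (qop a b) = qop (r a) (r b).

Section Naturality.
Variables (X Y : quandle) (r : X -> Y) (A B : zmodType) (s : {additive B -> A}).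
Hypothesis r_hom : quandle_hom r.

Lemma face_map n (x : n.+1.-tuple X) i :
  face (map_tuple r x) i = map_tuple r (face x i).
Proof. by apply: eq_from_tnth => k; rewrite !(tnth_mktuple, tnth_map). Qed.

Lemma face_op_map n (x : n.+1.-tuple X) i :
  face_op (map_tuple r x) i = map_tuple r (face_op x i).
Proof.
apply: eq_from_tnth => k; rewrite !(tnth_mktuple, tnth_map).
by case: ifP => _; rewrite ?r_hom.
Qed.

Lemma normalized_map n (phi : n.-tuple Y -> B) :
  normalized phi -> normalized (s \o phi \o map_tuple r).
Proof.
move=> phi_norm x [i [j [ij xij]]] /=.
by rewrite phi_norm ?raddf0 //; exists i, j; rewrite !tnth_map xij.
Qed.

Lemma tuple_coboundary_map n (phi : n.-tuple Y -> B) x :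
  tuple_coboundary (s \o phi \o map_tuple r) x =
  s (tuple_coboundary phi (map_tuple r x)).
Proof.
rewrite /tuple_coboundary raddf_sum; apply: eq_bigr => i _ /=.
by rewrite raddfMz raddfB face_map face_op_map.
Qed.

End Naturality.

(** If [s (phi (r x))] is the coboundary of psi, then restricting psi along i and
    composing it with p exhibits phi itself as a coboundary. *)
Lemma essential_cocycle_retract (X Y : quandle) (r : X -> Y) (i : Y -> X)
    (A B : zmodType) (s : {additive B -> A}) (p : {additive A -> B}) n
    (phi : n.+1.-tuple Y -> B) :
    quandle_hom r -> quandle_hom i -> cancel i r -> cancel s p ->
  essential_cocycle phi -> essential_cocycle (s \o phi \o map_tuple r).
Proof.
move=> r_hom i_hom iK sK [phi_norm phi_coc phi_ncob]; split.
- exact: normalized_map.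
- by move=> x; rewrite tuple_coboundary_map // phi_coc raddf0.
move=> psi psi_norm phiE; apply: (phi_ncob (p \o psi \o map_tuple i)).
  exact: normalized_map.
move=> x; rewrite tuple_coboundary_map // -phiE /= sK; congr phi.
by apply: eq_from_tnth => k; rewrite !tnth_map iK.
Qed.

(** * Coboundaries in low degrees *)

Lemma val_face (X : quandle) n (x : n.+1.-tuple X) (i : 'I_n.+1) :
  face x i = take i x ++ drop i.+1 x :> seq X.
Proof.
have i_lt := ltn_ord i; have x0 := tnth x ord0.
apply: (@eq_from_nth _ x0) => [|k].
  rewrite size_tuple size_cat size_take size_drop size_tuple i_lt subSS.
  by rewrite subnKC // -ltnS.
rewrite size_tuple => k_lt; rewrite -[k]/(nat_of_ord (Ordinal k_lt)) -tnth_nth.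
rewrite tnth_mktuple (tnth_nth x0) /= nth_cat size_take size_tuple i_lt.
rewrite /bump leqNgt; case: ltnP => ki; first by rewrite nth_take.
by rewrite nth_drop add1n addSn subnKC.
Qed.

Lemma val_face_op (X : quandle) n (x : n.+1.-tuple X) (i : 'I_n.+1) :
  face_op x i = [seq qop a (tnth x i) | a <- take i x] ++ drop i.+1 x :> seq X.
Proof.
have i_lt := ltn_ord i; have x0 := tnth x ord0.
apply: (@eq_from_nth _ x0) => [|k].
  rewrite size_tuple size_cat size_map size_take size_drop size_tuple i_lt subSS.
  by rewrite subnKC // -ltnS.
rewrite size_tuple => k_lt; rewrite -[k]/(nat_of_ord (Ordinal k_lt)) -tnth_nth.
rewrite tnth_mktuple !(tnth_nth x0 x (fintype.lift i _)) /=.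
rewrite nth_cat size_map size_take size_tuple i_lt /bump.
case: ltnP => ki; last by rewrite nth_drop add1n addSn subnKC.
by rewrite (nth_map x0) ?nth_take // size_take size_tuple i_lt.
Qed.

Lemma tuple_coboundary3 (X : quandle) (A : zmodType) (psi : 3.-tuple X -> A)
    (x1 x2 x3 x4 : X) :
  tuple_coboundary psi [tuple x1; x2; x3; x4] =
    (psi [tuple x1; x3; x4] - psi [tuple qop x1 x2; x3; x4])
  - (psi [tuple x1; x2; x4] - psi [tuple qop x1 x3; qop x2 x3; x4])
  + (psi [tuple x1; x2; x3] - psi [tuple qop x1 x4; qop x2 x4; qop x3 x4]).
Proof.
rewrite /tuple_coboundary !big_mkcond !big_ord_recl big_ord0 /= add0r addr0.
rewrite /bump /= !exprS !expr0 !mulN1r !opprK !mulrN1z !mulr1z ?addrA.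
congr (_ - _ - (_ - _) + _ - _); congr (psi _); apply: val_inj;
  by rewrite -[LHS]/(tval _) ?val_face ?val_face_op ?(tnth_nth x1).
Qed.

Lemma tuple_coboundary4 (X : quandle) (A : zmodType) (phi : 4.-tuple X -> A)
    (x1 x2 x3 x4 x5 : X) :
  tuple_coboundary phi [tuple x1; x2; x3; x4; x5] =
    (phi [tuple x1; x3; x4; x5] - phi [tuple qop x1 x2; x3; x4; x5])
  - (phi [tuple x1; x2; x4; x5] - phi [tuple qop x1 x3; qop x2 x3; x4; x5])
  + (phi [tuple x1; x2; x3; x5] -
     phi [tuple qop x1 x4; qop x2 x4; qop x3 x4; x5])
  - (phi [tuple x1; x2; x3; x4] -
     phi [tuple qop x1 x5; qop x2 x5; qop x3 x5; qop x4 x5]).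
Proof.
rewrite /tuple_coboundary !big_mkcond !big_ord_recl big_ord0 /= add0r addr0.
rewrite /bump /= !exprS !expr0 !mulN1r !opprK !mulrN1z !mulr1z ?addrA.
congr (_ - _ - (_ - _) + _ - _ - (_ - _)); congr (phi _); apply: val_inj;
  by rewrite -[LHS]/(tval _) ?val_face ?val_face_op ?(tnth_nth x1).
Qed.

(** * Jacobi sums and moments over a finite field *)

Section JacobiSums.
Variable k : finFieldType.
Implicit Types (u v w z : k) (a b c : nat).
Implicit Types (h : k -> k -> k) (Phi : k -> k -> k -> k).

(** As [0^-1 = 0], the function u |-> u^-a for a > 0 is a multiplicative
    character extended by 0 at 0; this is the Jacobi sum of two such. *)
Definition jacobi_sum a b : k := \sum_u u ^- a * (1 - u) ^- b.

(** Up to sign, for exponents between 1 and [#|k| - 2] these moments are the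
    coefficients of u^a v^b and u^a v^b w^c in the reduced polynomial that
    represents the function; as sums they need no polynomial expansion, only
    changes of variables. *)
Definition moment2 a b h : k := \sum_u \sum_v u ^- a * v ^- b * h u v.

Definition moment3 a b c Phi : k :=
  \sum_u \sum_v \sum_w u ^- a * v ^- b * w ^- c * Phi u v w.

Lemma sum_scale z (f : k -> k) : z != 0 -> \sum_u f (z * u) = \sum_u f u.
Proof. by move=> z0; rewrite [RHS](reindex_inj (mulfI z0)). Qed.

Lemma exprVMn z u a : (z * u) ^- a = z ^- a * u ^- a.
Proof. by rewrite exprMn invfM. Qed.

Lemma jacobi_sumC a b : jacobi_sum a b = jacobi_sum b a.
Proof.
rewrite /jacobi_sum (reindex_inj (inv_inj (subKr 1))) /=.
by apply: eq_bigr => u _; rewrite subKr mulrC.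
Qed.

Lemma jacobi_sum_scale a b z : z != 0 ->
  \sum_u u ^- a * (z - u) ^- b = z ^- (a + b) * jacobi_sum a b.
Proof.
move=> z0; rewrite -(sum_scale _ z0) mulr_sumr; apply: eq_bigr => u _.
by rewrite -[z in z - _]mulr1 -mulrBr !exprVMn exprD invfM mulrACA.
Qed.

(** The substitution v = s - u makes the inner sum a rescaled Jacobi sum for
    every s <> 0; the term s = 0 is where [f 0 = 0] enters. *)
Lemma convolution_sum a b (f : k -> k) : f 0 = 0 ->
  \sum_u \sum_v u ^- a * v ^- b * f (u + v) =
  jacobi_sum a b * \sum_u u ^- (a + b) * f u.
Proof.
move=> f0; transitivity (\sum_u \sum_s u ^- a * (s - u) ^- b * f s).
  apply: eq_bigr => u _; rewrite [RHS](reindex_inj (addrI u)).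
  by apply: eq_bigr => v _; rewrite /= [u + v]addrC addrK.
rewrite exchange_big mulr_sumr; apply: eq_bigr => s _ /=.
rewrite -mulr_suml; have [->|s0] := eqVneq s 0; first by rewrite f0 !mulr0.
by rewrite jacobi_sum_scale // mulrA [_ * jacobi_sum _ _]mulrC.
Qed.

Lemma moment3B a b c Phi Psi :
  moment3 a b c (fun u v w => Phi u v w - Psi u v w) =
  moment3 a b c Phi - moment3 a b c Psi.
Proof.
rewrite /moment3 -sumrB; apply: eq_bigr => u _.
rewrite -sumrB; apply: eq_bigr => v _.
by rewrite -sumrB; apply: eq_bigr => w _; rewrite mulrBr.
Qed.

Lemma eq_moment3 a b c Phi Psi : (forall u v w, Phi u v w = Psi u v w) ->
  moment3 a b c Phi = moment3 a b c Psi.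
Proof. by move=> E; do 3!(apply: eq_bigr => ? _); rewrite E. Qed.

Lemma moment3_scale a b c Phi x y z : x != 0 -> y != 0 -> z != 0 ->
  moment3 a b c (fun u v w => Phi (x * u) (y * v) (z * w)) =
  x ^+ a * y ^+ b * z ^+ c * moment3 a b c Phi.
Proof.
move=> x0 y0 z0; rewrite /moment3 [in RHS](reindex_inj (mulfI x0)) mulr_sumr.
apply: eq_bigr => u _; rewrite [in RHS](reindex_inj (mulfI y0)) mulr_sumr.
apply: eq_bigr => v _; rewrite [in RHS](reindex_inj (mulfI z0)) mulr_sumr.
apply: eq_bigr => w _; rewrite /= !exprVMn.
move: (u ^- a) (v ^- b) (w ^- c) => u' v' w'.
by field; rewrite !expf_neq0.
Qed.

Lemma moment3_convl a b c h : (forall w, h 0 w = 0) ->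
  moment3 a b c (fun u v w => h (u + v) w) =
  jacobi_sum a b * moment2 (a + b) c h.
Proof.
move=> h0; rewrite /moment2 exchange_big mulr_sumr /=.
transitivity (\sum_w \sum_u \sum_v u ^- a * v ^- b * (w ^- c * h (u + v) w)).
  rewrite exchange_big /=; apply: eq_bigr => u _; rewrite exchange_big /=.
  by do 2!(apply: eq_bigr => ? _); rewrite mulrA.
apply: eq_bigr => w _.
rewrite (convolution_sum _ _ (f := fun s => w ^- c * h s w)) ?h0 ?mulr0 //.
by congr (_ * _); apply: eq_bigr => u _; rewrite mulrA.
Qed.

Lemma moment3_convr a b c h : (forall u, h u 0 = 0) ->
  moment3 a b c (fun u v w => h u (v + w)) =
  jacobi_sum b c * moment2 a (b + c) h.
Proof.
move=> h0; rewrite /moment2 mulr_sumr; apply: eq_bigr => u _ /=.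
transitivity (\sum_v \sum_w v ^- b * w ^- c * (u ^- a * h u (v + w))).
  by do 2!(apply: eq_bigr => ? _); rewrite mulrCA !mulrA.
rewrite (convolution_sum _ _ (f := fun s => u ^- a * h u s)) ?h0 ?mulr0 //.
by congr (_ * _); apply: eq_bigr => v _; rewrite mulrCA mulrA.
Qed.

Definition power_sum a b : k := \sum_u u ^- a * u ^+ b.

Lemma moment3_monomial a b c a' b' c' :
  moment3 a b c (fun u v w => u ^+ a' * v ^+ b' * w ^+ c') =
  power_sum a a' * power_sum b b' * power_sum c c'.
Proof.
rewrite /power_sum big_distrlr mulr_suml; apply: eq_bigr => u _ /=.
rewrite mulr_suml; apply: eq_bigr => v _; rewrite mulr_sumr.
apply: eq_bigr => w _; move: (u ^- a) (v ^- b) (w ^- c) => u' v' w'.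
by ring.
Qed.

(** The substitution u := z u multiplies the sum by z^(b - a), which is not 1. *)
Lemma power_sum_eq0 z a b : z != 0 -> z ^+ a != z ^+ b -> power_sum a b = 0.
Proof.
move=> z0 zab; have : z ^+ a * power_sum a b = z ^+ b * power_sum a b.
  rewrite {1}/power_sum -(sum_scale _ z0) !mulr_sumr; apply: eq_bigr => u _.
  by rewrite exprVMn exprMn; move: (u ^- a) => u'; field; rewrite expf_neq0.
by move/eqP; rewrite -subr_eq0 -mulrBl mulf_eq0 subr_eq0 (negPf zab) => /eqP.
Qed.

Lemma power_sum_diag a : (0 < a)%N -> power_sum a a = -1.
Proof.
move=> a0; have E u : u ^- a * u ^+ a = 1 - (u == 0)%:R.
  have [->|u0] := eqVneq u 0; first by rewrite expr0n eqn0Ngt a0 mulr0 subrr.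
  by rewrite mulVf ?expf_neq0 // subr0.
rewrite /power_sum (eq_bigr _ (fun u _ => E u)) sumrB.
have -> : \sum_(u : k) (u == 0)%:R = 1 :> k.
  by rewrite (bigD1 0) //= big1 ?eqxx ?addr0 // => u /negPf->.
(* translating u by 1 adds to sum_u u the sum of all ones *)
suff -> : \sum_(u : k) 1 = 0 :> k by rewrite sub0r.
apply: (addrI (\sum_(u : k) u)); rewrite addr0 -big_split.
by rewrite [RHS](reindex_inj (addIr 1)).
Qed.

Lemma pchar_sum_pow (p : nat) (I : finType) (f : I -> k) j : p \in [pchar k] ->
  (\sum_i f i) ^+ (p ^ j)%N = \sum_i f i ^+ (p ^ j)%N.
Proof.
move=> pk; have pj : [pchar k].-nat (p ^ j)%N.
  by rewrite pnatX pnatE ?pk ?(pcharf_prime pk).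
apply: (big_morph (fun x => x ^+ (p ^ j)%N)) => [x y|].
  exact: exprDn_pchar.
by rewrite expr0n expn_eq0 eqn0Ngt (prime_gt0 (pcharf_prime pk)).
Qed.

(** Away from u = 0 and u = 1, 1/(u (1-u)) = 1/u + 1/(1-u), and the two summands
    have the same sum. *)
Lemma jacobi_sum11 : 2 \in [pchar k] -> jacobi_sum 1 1 = 0.
Proof.
move=> char2; pose d u w : k := (u == w)%:R.
have E u : u ^- 1 * (1 - u) ^- 1 = u^-1 + (1 - u)^-1 - (d u 0 + d u 1).
  rewrite /d !expr1; have [->|u0] := eqVneq u 0.
    by rewrite invr0 subr0 invr1 eq_sym oner_eq0 mul0r add0r addr0 subrr.
  have [->|u1] := eqVneq u 1.
    by rewrite subrr invr0 invr1 mulr0 addr0 add0r subrr.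
  rewrite addr0 subr0; field.
  by rewrite u0 subr_eq0 (eq_sym 1) u1.
rewrite /jacobi_sum (eq_bigr _ (fun u _ => E u)) sumrB !big_split /=.
have S : \sum_u (1 - u)^-1 = \sum_u u^-1 :> k.
  by rewrite [RHS](reindex_inj (inv_inj (subKr 1))).
have D w : \sum_u d u w = 1.
  by rewrite (bigD1 w) //= big1 ?/d ?eqxx ?addr0 // => u /negPf->.
by rewrite S !D -!mulr2n -mulr_natr -[1 *+ 2]/(2%:R) pcharf0 // mulr0 subr0.
Qed.

(** This is the image of J(1,1) = 0 under a power of Frobenius. *)
Lemma jacobi_sum_diag j : 2 \in [pchar k] -> jacobi_sum (2 ^ j)%N (2 ^ j)%N = 0.
Proof.
move=> char2; transitivity (jacobi_sum 1 1 ^+ (2 ^ j)).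
  rewrite /jacobi_sum pchar_sum_pow //.
  by apply: eq_bigr => u _; rewrite !expr1 exprMn !exprVn.
by rewrite jacobi_sum11 // expr0n expn_eq0.
Qed.

End JacobiSums.

(** * The trilinear cocycle over a finite field *)

Lemma prim_root_neq0 (k : fieldType) m (z : k) : m.-primitive_root z -> z != 0.
Proof.
move=> z_prim; apply: contra_eq_neq (prim_expr_order z_prim) => ->.
by rewrite expr0n gtn_eqF ?(prim_order_gt0 z_prim) // eq_sym oner_eq0.
Qed.

Section FieldQuandle.
Variables (k : finFieldType) (z : k) (j : nat).
Local Notation a := (2 ^ j)%N.
Hypothesis char2 : 2 \in [pchar k].
Hypothesis z_unit : exists u, u * z = 1.

Definition field_quandle : quandle := alexander k^o z_unit.

Definition trilinear_cocycle (x : 4.-tuple field_quandle) : k :=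
  let y := nth (0 : k) x in
  (y 0%N - y 1%N) ^+ a * (y 1%N - y 2%N) ^+ a * (y 2%N - y 3%N).

Lemma frobeniusD (u v : k) : (u + v) ^+ a = u ^+ a + v ^+ a.
Proof. by rewrite exprDn_pchar // pnatX pnatE ?char2. Qed.

Lemma frobeniusN (u : k) : (- u) ^+ a = - u ^+ a.
Proof.
by apply/eqP; rewrite -subr_eq0 opprK -frobeniusD addNr expr0n expn_eq0.
Qed.

Lemma trilinear_cocycle_normalized : normalized trilinear_cocycle.
Proof.
move=> x [i [i' [ii']]]; rewrite !(tnth_nth (0 : k)) ii' /trilinear_cocycle.
have a0 : (0 < a)%N by rewrite expn_gt0.
have: (i.+1 < 4)%N by rewrite -ii' ltn_ord.
case: (nat_of_ord i) => [|[|[|//]]] _ ->;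
  by rewrite subrr ?expr0n ?eqn0Ngt ?a0 ?(mul0r, mulr0).
Qed.

Lemma tuple5P (T : Type) (x : 5.-tuple T) :
  exists x1 x2 x3 x4 x5, x = [tuple x1; x2; x3; x4; x5].
Proof.
case: x => [[|x1 [|x2 [|x3 [|x4 [|x5 [|//]]]]]] //= s5].
by exists x1, x2, x3, x4, x5; apply: val_inj.
Qed.

Lemma trilinear_cocycle_coboundary x : tuple_coboundary trilinear_cocycle x = 0.
Proof.
have [x1 [x2 [x3 [x4 [x5 ->]]]]] := tuple5P x.
have qopE (u v : k) : qop (u : field_quandle) v = z * u + (1 - z) * v by [].
rewrite tuple_coboundary4 !qopE /trilinear_cocycle /=.
rewrite !(frobeniusD, frobeniusN, exprMn, expr1n).
move: (x1 : k) (x2 : k) (x3 : k) (x4 : k) (x5 : k) => y1 y2 y3 y4 y5.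
by ring.
Qed.

(* with a = 2^j this order is 2a + 1 *)
Hypothesis z_prim : (2 ^ j.+1 + 1).-primitive_root z.

(** The identity refuted here is [F = d g] for the trilinear F, read off at
    x4 = 0 in the coordinates u = x1-x2, v = x2-x3, w = x3. *)
Lemma monomial_not_coboundary (h : k -> k -> k) (G : k -> k -> k -> k) :
    (forall w, h 0 w = 0) -> (forall u, h u 0 = 0) ->
  ~ (forall u v w, u ^+ a * v ^+ a * w ^+ 1 =
       h (u + v) w - h (z * u + v) w
       - (h u (v + w) - h (z * u) (z * v + w))
       + (G u v w - G (z * u) (z * v) (z * w))).
Proof.
move=> h0l h0r FE.
have z0 := prim_root_neq0 z_prim.
have a0 : (0 < a)%N by rewrite expn_gt0.
have mE : (2 ^ j.+1 + 1 = a + a + 1)%N by rewrite expnS mul2n -addnn.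
(* pairing with u^-b v^-c w^-d: the G terms cancel since z^(b+c+d) = 1 *)
have moments b c d : (b + c + d = a + a + 1)%N ->
    power_sum k b a * power_sum k c a * power_sum k d 1 =
    (1 - z ^+ b) * jacobi_sum k b c * moment2 (b + c) d h
    - (1 - z ^+ (b + c)) * jacobi_sum k c d * moment2 b (c + d) h.
  move=> bcd; rewrite -moment3_monomial (eq_moment3 _ _ _ FE).
  (* the factors 1 make every term an instance of [moment3_scale] *)
  rewrite (eq_moment3 _ _ _ (Psi := fun u v w =>
    h (u + v) w - h (z * u + 1 * v) (1 * w)
    - (h u (v + w) - h (z * u) (z * v + 1 * w))
    - (G (z * u) (z * v) (z * w) - G u v w))); last first.
    by move=> u v w; rewrite !mul1r; congr (_ + _); rewrite opprB.
  rewrite !moment3B.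
  rewrite (moment3_scale _ _ _ (fun u v w => h (u + v) w)) ?oner_eq0 //.
  rewrite (moment3_scale _ _ _ (fun u v w => h u (v + w))) ?oner_eq0 //.
  rewrite (moment3_scale _ _ _ G) // -!exprD bcd -mE (prim_expr_order z_prim).
  rewrite !expr1n moment3_convl // moment3_convr //.
  by ring.
have m_gt : (a + 1 < a + a + 1)%N by rewrite ltn_add2r -addn1 leq_add2l.
have z_inj b c : (b < a + a + 1)%N -> (c < a + a + 1)%N ->
    (z ^+ b == z ^+ c) = (b == c).
  by move=> b_lt c_lt; rewrite (eq_prim_root_expr z_prim) mE !modn_small.
have z_neq1 c : (0 < c)%N -> (c < a + a + 1)%N -> 1 - z ^+ c != 0.
  by case: c => // c _ c_lt; rewrite subr_eq0 -(expr0 z) z_inj // addn1.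
(* for (b, c, d) = (a, a, 1) the monomial has moment (-1)^3 *)
suff J0 : jacobi_sum k a 1 * moment2 a (a + 1) h = 0.
  have := moments a a 1%N erefl.
  rewrite jacobi_sum_diag // -[(1 - z ^+ (a + a)) * _ * _]mulrA J0.
  rewrite !mulr0 mul0r subrr !power_sum_diag //.
  by apply/eqP; rewrite !(mulN1r, opprK, mul1r) oppr_eq0 oner_eq0.
have [a1|a1] := eqVneq a 1%N.
  by rewrite {1}a1 -(expn0 2) jacobi_sum_diag // mul0r.
have S0 : power_sum k 1 a = 0.
  apply: (power_sum_eq0 z0); rewrite z_inj ?(eq_sym 1%N) //.
    by rewrite addn1 ltnS addn_gt0 a0.
  by rewrite addn1 ltnS leq_addr.
have J1 : jacobi_sum k a 1 * moment2 (a + 1) a h = 0.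
  have := moments 1%N a a; rewrite -addnA addnC => /(_ erefl).
  rewrite S0 !mul0r jacobi_sum_diag // mulr0 mul0r subr0 -mulrA => /esym/eqP.
  rewrite mulf_eq0 (negPf (z_neq1 1%N _ _)) //=; last first.
    by rewrite addn1 ltnS addn_gt0 a0.
  by rewrite jacobi_sumC addnC => /eqP.
have := moments a 1%N a (addnAC _ _ _).
rewrite S0 mulr0 mul0r -[(1 - z ^+ a) * _ * _]mulrA J1 mulr0 sub0r => /esym/eqP.
rewrite oppr_eq0 -mulrA mulf_eq0 (negPf (z_neq1 _ _ m_gt)) ?addn1 //=.
by rewrite jacobi_sumC => /eqP.
Qed.

Lemma trilinear_cocycle_essential : essential_cocycle trilinear_cocycle.
Proof.
split=> [||psi psi_norm psiE].
- exact: trilinear_cocycle_normalized.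
- exact: trilinear_cocycle_coboundary.
pose T (x y w : k) : 3.-tuple field_quandle :=
  [tuple (x : field_quandle); y; w].
have deg (x : 3.-tuple field_quandle) i :
    (i < 2)%N -> nth (0 : k) x i = nth (0 : k) x i.+1 -> psi x = 0.
  move=> i_lt xi; apply: psi_norm.
  exists (inord i), (inord i.+1); rewrite !(tnth_nth (0 : k)) !inordK //.
  exact: ltnW.
have qopE (u v : k) : qop (u : field_quandle) v = z * u + (1 - z) * v by [].
pose h (s w : k) := psi (T (s + w) w 0).
pose G u v w := psi (T (u + v + w) (v + w) w).
apply: (@monomial_not_coboundary h G) => [w|u|u v w].
- by apply: (deg _ 0%N) => //=; rewrite add0r.
- exact: (deg _ 1%N).
have /= := psiE [tuple (u + v + w : field_quandle); v + w; w; (0 : k)].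
rewrite tuple_coboundary3 !qopE /trilinear_cocycle /= subr0 expr1.
rewrite -[u + v + w]addrA addrK addrK => ->; rewrite /h /G.
have eqT x y s x' y' s' : x = x' -> y = y' -> s = s' ->
    psi (T x y s) = psi (T x' y' s') by move=> -> -> ->.
by congr (_ - _ - (_ - _) + (_ - _)); apply: eqT; ring.
Qed.

End FieldQuandle.

(** * Evaluation of Laurent polynomials *)

Section LaurentEvaluation.
Local Notation "p %:F" := (FracField.tofrac p).

(** R[t,1/t] is the localization of R[t] at t: a morphism out of R[t] that maps
    t to a unit extends to it, by p / t^l |-> phi(p) / phi(t)^l. *)
Lemma laurent_eval (R : idomainType) (K : fieldType)
    (phi : {rmorphism {poly R} -> K}) : phi 'X != 0 ->
  exists ev : {rmorphism laurent R -> K}, ev (laurentX R) = phi 'X.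
Proof.
move=> phiX.
have frac (x : laurent R) : {pl : {poly R} * nat |
    laurent_val x * 'X%:F ^+ pl.2 = pl.1%:F}.
  apply: cid; case: x => x /= /is_laurentP[p [l ->]]; exists (p, l) => /=.
  by rewrite divfK // expf_neq0 // fracX_neq0.
pose ev x : K := phi (sval (frac x)).1 / phi 'X ^+ (sval (frac x)).2.
have evE (x : laurent R) p l :
    laurent_val x * 'X%:F ^+ l = p%:F -> ev x = phi p / phi 'X ^+ l.
  rewrite /ev; case: (frac x) => -[q d] /= xq xp.
  have /eqP : (q * 'X^l)%:F = (p * 'X^d)%:F.
    by rewrite !tofracM !tofracXn -xq -xp mulrAC.
  rewrite tofrac_eq => /eqP/(congr1 phi); rewrite !rmorphM !rmorphXn => qp.
  by apply/eqP; rewrite eqr_div ?expf_neq0 // qp.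
have evB : zmod_morphism ev.
  move=> x y; have [[p d] /= xp] := frac x; have [[q l] /= yq] := frac y.
  rewrite (evE _ _ _ xp) (evE _ _ _ yq) (evE _ (p * 'X^l - q * 'X^d) (d + l)%N).
    by rewrite rmorphB !rmorphM !rmorphXn exprD; field; rewrite !expf_neq0.
  rewrite tofracB !tofracM !tofracXn -xp -yq exprD /=; ring.
have evM : monoid_morphism ev.
  split=> [|x y].
    have -> : ev 1 = phi 1 / phi 'X ^+ 0 by apply: evE; rewrite mulr1 tofrac1.
    by rewrite rmorph1 divr1.
  have [[p d] /= xp] := frac x; have [[q l] /= yq] := frac y.
  rewrite (evE _ _ _ xp) (evE _ _ _ yq) (evE _ (p * q) (d + l)%N).
    by rewrite rmorphM exprD; field; rewrite !expf_neq0.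
  by rewrite tofracM -xp -yq exprD /=; ring.
pose ev_add := GRing.isZmodMorphism.Build _ _ ev evB.
pose ev_mul := GRing.isMonoidMorphism.Build _ _ ev evM.
pose ev_rm : {rmorphism laurent R -> K} := HB.pack ev ev_add ev_mul.
exists ev_rm; rewrite -[LHS]/(ev _) (evE _ 'X 0%N) ?divr1 //.
by rewrite mulr1.
Qed.

End LaurentEvaluation.

(** * Roots of unity and the trace of the field of order 2^(2n) *)

(** 2^n + 1 divides 2^(2n) - 1, the order of the cyclic group of units. *)
Lemma exists_field_prim_root n : (0 < n)%N ->
  exists (k : finFieldType) (z : k),
    [/\ 2 \in [pchar k], #|k| = (2 ^ (n + n))%N
      & (2 ^ n + 1).-primitive_root z].
Proof.
move=> n_gt0; have nn_gt0 : (0 < n + n)%N by rewrite addn_gt0 n_gt0.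
have [k char2 card_k] := pPrimePowerField (isT : prime 2) nn_gt0.
have q_gt0 : (0 < #|k|.-1)%N.
  by rewrite -ltnS prednK card_k ?expn_gt0 // -{1}(expn0 2) ltn_exp2l.
have /hasP[g _ g_prim] : has #|k|.-1.-primitive_root (enum (predC1 (0 : k))).
  apply: has_prim_root => //; last by rewrite -cardE cardC1.
    apply/allP => x; rewrite mem_enum inE => x0.
    rewrite unity_rootE; apply/eqP/(mulfI x0).
    by rewrite -exprS prednK ?expf_card ?mulr1 // card_k expn_gt0.
  exact: enum_uniq.
have m_dvd : (2 ^ n + 1 %| #|k|.-1)%N.
  by rewrite card_k expnD mulnn -subn1 -(exp1n 2) subn_sqr dvdn_mull.
exists k, (g ^+ (#|k|.-1 %/ (2 ^ n + 1))); split=> //.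
exact: dvdn_prim_root.
Qed.

Section TraceForm.
Variables (k : finFieldType) (n : nat) (z : k).
Hypothesis n_gt0 : (0 < n)%N.
Hypothesis char2 : 2 \in [pchar k].
Hypothesis card_k : #|k| = (2 ^ (n + n))%N.
Hypothesis z_prim : (2 ^ n + 1).-primitive_root z.

(** The trace of k over its prime field, as a sum over the Galois group. *)
Definition trace (v : k) : k := \sum_(j < n + n) v ^+ (2 ^ j).

Lemma traceD u v : trace (u + v) = trace u + trace v.
Proof.
rewrite /trace -big_split; apply: eq_bigr => j _.
by rewrite exprDn_pchar // pnatX pnatE ?char2.
Qed.

Lemma trace_eq01 v : trace v = 0 \/ trace v = 1.
Proof.
have tr2 : trace v ^+ 2 = trace v.
  transitivity (\sum_(j < n + n) v ^+ (2 ^ j.+1)).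
    rewrite -{1}(expn1 2) /trace (pchar_sum_pow _ _ char2).
    by apply: eq_bigr => j _; rewrite -exprM -expnD addn1.
  have [N nnE] : exists N, (n + n = N.+1)%N.
    by exists (n + n).-1; rewrite prednK // addn_gt0 n_gt0.
  rewrite /trace nnE [RHS]big_ord_recl [LHS]big_ord_recr addrC; congr (_ + _).
  by rewrite /= expr1 -nnE -card_k expf_card.
have /eqP : trace v * (trace v - 1) = 0.
  by rewrite mulrBr mulr1 -expr2 tr2 subrr.
by rewrite mulf_eq0 subr_eq0 => /orP[] /eqP; [left | right].
Qed.

Lemma sum_root_of_unity (w : k) m :
  w ^+ m = 1 -> w != 1 -> \sum_(i < m) w ^+ i = 0.
Proof.
move=> wm w1; have /eqP := subrX1 w m.
by rewrite wm subrr eq_sym mulf_eq0 subr_eq0 (negPf w1) => /eqP.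
Qed.

(** That is, 2^j is not 1 modulo 2^n + 1: for j <= n because
    0 < 2^j - 1 < 2^n + 1, and for j > n because 2^j = - 2^(j-n) and
    0 < 2^(j-n) + 1 < 2^n + 1. *)
Lemma prim_root_frobenius j : (0 < j < n + n)%N -> z ^+ (2 ^ j) != z.
Proof.
case/andP=> j_gt0 j_lt; apply/eqP => zj.
have z_dvd i : z ^+ i = 1 -> (2 ^ n + 1 %| i)%N.
  by move=> zi; rewrite (prim_order_dvd z_prim) zi.
have z0 := prim_root_neq0 z_prim.
have [j_le|n_lt] := leqP j n.
  have : (2 ^ n + 1 %| 2 ^ j - 1)%N.
    apply: z_dvd; apply: (mulfI z0).
    by rewrite -exprS subn1 prednK ?expn_gt0 // zj mulr1.
  move/dvdn_leq; rewrite subn_gt0 -{1}(expn0 2) ltn_exp2l // => /(_ j_gt0).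
  rewrite leqNgt; case/negP.
  by rewrite addn1 ltnS (leq_trans (leq_subr _ _)) // leq_exp2l.
have : (2 ^ n + 1 %| (2 ^ (j - n)).+1)%N.
  apply: z_dvd; rewrite exprS -{1}zj -{1}(subnKC (ltnW n_lt)) expnD exprM.
  by rewrite -exprMn -exprSr -addn1 (prim_expr_order z_prim) expr1n.
move/dvdn_leq => /(_ isT); rewrite addn1 ltnS leqNgt ltn_exp2l //.
by rewrite ltn_subLR ?j_lt // ltnW.
Qed.

(** Expanding the trace and exchanging the sums leaves, for each j, a sum of the
    powers of z^(1 - 2^j); it is 0 unless j = 0, and 2^n + 1 = 1 in k if j = 0. *)
Lemma trace_reconstruction v :
  \sum_(i < 2 ^ n + 1) trace (v * z ^- i) * z ^+ i = v.
Proof.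
have z0 := prim_root_neq0 z_prim.
transitivity (\sum_(j < n + n) v ^+ (2 ^ j) *
    \sum_(i < 2 ^ n + 1) (z ^- (2 ^ j) * z) ^+ i).
  rewrite (eq_bigr (fun i : 'I_(2 ^ n + 1) => \sum_(j < n + n)
     v ^+ (2 ^ j) * (z ^- (2 ^ j) * z) ^+ i)) => [|i _].
    by rewrite exchange_big; apply: eq_bigr => j _; rewrite mulr_sumr.
  rewrite mulr_suml; apply: eq_bigr => j _.
  rewrite !exprMn mulrA; congr (_ * _ * _).
  by rewrite !exprVn -!exprM mulnC.
have [N nnE] : exists N, (n + n = N.+1)%N.
  by exists (n + n).-1; rewrite prednK // addn_gt0 n_gt0.
rewrite nnE big_ord_recl [X in _ + X]big1 /= => [|j _].
  under eq_bigr do rewrite mulVf // expr1n.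
  rewrite addr0 sumr_const card_ord natrD natrX (pcharf0 char2) expr0n.
  by rewrite (gtn_eqF n_gt0) add0r mulr1 expr1.
rewrite sum_root_of_unity ?mulr0 //.
  by rewrite exprMn exprVn exprAC (prim_expr_order z_prim) expr1n invr1 mulr1.
rewrite mulrC -(inj_eq (mulIf (expf_neq0 (2 ^ fintype.lift ord0 j) z0))).
rewrite divfK ?expf_neq0 //.
by rewrite mul1r eq_sym prim_root_frobenius // nnE ltn_ord.
Qed.

End TraceForm.

(** * The field as a retract of the quandle *)

Section XiRing.
Variable n : nat.
Local Notation t := (xi_t n).

Lemma xi_ring_pchar2 : 2 \in [pchar xi_ring n].
Proof.
suff two0 : 2%:R = 0 :> laurent 'F_2.
  by rewrite inE /= -(rmorph_nat \pi_(xi_ring n)) two0 rmorph0 eqxx.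
apply: val_inj; rewrite (rmorph_nat (\val : {rmorphism laurent 'F_2 -> _})).
rewrite -(rmorph_nat (@FracField.tofrac {poly 'F_2})) -(rmorph_nat (@polyC 'F_2)).
by rewrite (_ : 2%:R = 0 :> 'F_2) ?raddf0 //; apply/val_inj.
Qed.

Lemma xi_t_expr_order : t ^+ (2 ^ n + 1) = 1.
Proof.
have xi0 : \sum_(i < 2 ^ n + 1) (- t) ^+ i = 0.
  transitivity (\pi_(xi_ring n) (xi (2 ^ n + 1)%N)).
    by rewrite rmorph_sum; apply: eq_bigr => i _; rewrite rmorphXn rmorphN.
  apply/eqP; rewrite -[X in _ == X](rmorph0 \pi_(xi_ring n)).
  rewrite -Quotient.idealrBE subr0.
  by apply/xi_idealP; exists 1; rewrite mul1r.
have := subrX1 (- t) (2 ^ n + 1); rewrite xi0 mulr0 => /eqP.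
by rewrite subr_eq0 (oppr_pchar2 xi_ring_pchar2) => /eqP.
Qed.

Variables (k : finFieldType) (z : k).
Hypothesis n_gt0 : (0 < n)%N.
Hypothesis char2 : 2 \in [pchar k].
Hypothesis card_k : #|k| = (2 ^ (n + n))%N.
Hypothesis z_prim : (2 ^ n + 1).-primitive_root z.

Lemma xi_ring_eval : exists p : {additive xi_ring n -> k},
  p 1 = 1 /\ forall x, p (t * x) = z * p x.
Proof.
have z0 := prim_root_neq0 z_prim.
pose phi : {rmorphism {poly 'F_2} -> pPrimeCharType char2} :=
  horner_alg (z : pPrimeCharType char2).
have phiX : phi 'X = z by rewrite /phi /= horner_algX.
have [|ev evX] := @laurent_eval 'F_2 (pPrimeCharType char2) phi.
  by rewrite phiX.
rewrite phiX in evX.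
have ev_xi x : x \in xi_ideal n -> ev x = 0.
  move=> /xi_idealP[q ->]; rewrite rmorphM rmorph_sum /=.
  under eq_bigr do rewrite rmorphXn rmorphN evX (oppr_pchar2 char2).
  rewrite [X in _ * X](@sum_root_of_unity k) ?mulr0 ?(prim_expr_order z_prim) //.
  rewrite -[z]expr1 -(prim_order_dvd z_prim) gtnNdvd // addn1 ltnS.
  by rewrite expn_gt0.
pose p (x : xi_ring n) : k := ev (repr x).
have p_pi x : p (\pi_(xi_ring n) x) = ev x.
  apply/eqP; rewrite -subr_eq0 -[_ - _](raddfB ev); apply/eqP/ev_xi.
  by rewrite Quotient.idealrBE reprK.
have pB : zmod_morphism p.
  by move=> x y; rewrite -[x]reprK -[y]reprK -raddfB !p_pi raddfB.
pose p_add := GRing.isZmodMorphism.Build _ _ p pB.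
pose P : {additive xi_ring n -> k} := HB.pack p p_add.
exists P; split=> [|x].
  by rewrite -[LHS]/(p 1) -(rmorph1 \pi_(xi_ring n)) p_pi rmorph1.
by rewrite -[x]reprK -rmorphM -![P _]/(p _) !p_pi rmorphM evX.
Qed.

(** On {0, 1} this is the additive map from the prime field of k to R, for R of
    characteristic 2. *)
Definition bit (R : nzRingType) (v : k) : R := if v == 0 then 0 else 1.

(** A discrete Fourier transform: taking traces puts the coefficients in the
    prime field, which acts on any ring of characteristic 2, and the exponent -i
    makes multiplication of v by z shift them by one step. *)
Definition trace_section (v : k) : xi_ring n :=
  \sum_(i < 2 ^ n + 1) bit _ (trace n (v * z ^- i)) * t ^+ i.

Lemma bit_traceD u v :
  bit (xi_ring n) (trace n (u + v)) = bit _ (trace n u) + bit _ (trace n v).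
Proof.
have two0 : 1 + 1 = 0 :> k by apply: addrr_pchar2.
have two0_xi : 1 + 1 = 0 :> xi_ring n by apply: addrr_pchar2 xi_ring_pchar2 _.
rewrite traceD // /bit.
case: (trace_eq01 n_gt0 char2 card_k u) => ->;
  case: (trace_eq01 n_gt0 char2 card_k v) => ->;
  by rewrite ?two0 ?add0r ?addr0 ?eqxx ?oner_eq0 ?two0_xi ?add0r ?addr0.
Qed.

Lemma trace_sectionB : zmod_morphism trace_section.
Proof.
move=> u v; apply: (addIr (trace_section v)); rewrite subrK -big_split.
apply: eq_bigr => i _; rewrite /= -mulrDl -bit_traceD.
by congr (bit _ (trace n _) * _); rewrite -mulrDl subrK.
Qed.

(** The shift of the coefficients is cyclic because t^(2^n+1) = 1. *)
Lemma trace_section_scale v : trace_section (z * v) = t * trace_section v.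
Proof.
have z0 := prim_root_neq0 z_prim.
pose g i := bit (xi_ring n) (trace n (z * v * z ^- i)) * t ^+ i.
have -> : t * trace_section v = \sum_(i < 2 ^ n + 1) g i.+1.
  rewrite mulr_sumr; apply: eq_bigr => i _; rewrite /g mulrCA -exprS.
  congr (bit _ (trace n _) * _).
  by rewrite exprS invfM [z * v]mulrC -[RHS]mulrA mulVKf.
have g_per : g (2 ^ n + 1)%N = g 0%N.
  by rewrite /g xi_t_expr_order (prim_expr_order z_prim).
rewrite /trace_section -[LHS]/(\sum_(i < 2 ^ n + 1) g i).
rewrite addn1 in g_per *.
by rewrite [LHS]big_ord_recl [RHS]big_ord_recr /= g_per addrC.
Qed.

Lemma trace_sectionK (p : {additive xi_ring n -> k}) :
  p 1 = 1 -> (forall x, p (t * x) = z * p x) -> cancel trace_section p.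
Proof.
move=> p1 pt v; rewrite -[RHS](trace_reconstruction n_gt0 char2 z_prim).
have pX i : p (t ^+ i) = z ^+ i.
  by elim: i => [|i IH]; rewrite ?expr0 // !exprS pt IH.
rewrite raddf_sum; apply: eq_bigr => i _; rewrite /bit.
case: (trace_eq01 n_gt0 char2 card_k (v * z ^- i)) => ->.
  by rewrite eqxx !mul0r raddf0.
by rewrite oner_eq0 !mul1r.
Qed.

End XiRing.

(** * Non-triviality of the fourth cohomology *)

Theorem theorem4p3 (n : nat) (n_gt0 : (0 < n)%N) :
  exists h : quandle_cohomology (xi_quandle n) (xi_ring n) 4, h != 0.
Proof.
have [k [z [char2 card_k z_prim]]] := exists_field_prim_root n_gt0.
have z_unit : exists u, u * z = 1.
  by exists z^-1; rewrite mulVf // (prim_root_neq0 z_prim).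
have [p [p1 pt]] := xi_ring_eval char2 z_prim.
pose s_add :=
  GRing.isZmodMorphism.Build _ _ _ (trace_sectionB z n_gt0 char2 card_k).
pose s : {additive k -> xi_ring n} := HB.pack (trace_section n z) s_add.
have sK : cancel s p by exact: trace_sectionK.
have essential : exists phi : 4.-tuple (field_quandle z_unit) -> k,
    essential_cocycle phi.
  case: n n_gt0 z_prim {card_k p p1 pt s_add s sK} => // j _ z_prim.
  exists (trilinear_cocycle j (z_unit := z_unit)).
  exact: trilinear_cocycle_essential.
have [phi phi_ess] := essential.
have p_hom : @quandle_hom (xi_quandle n) (field_quandle z_unit) p.
  move=> a b.
  rewrite -[LHS]/(p (xi_t n * (a : xi_ring n) +
                     (1 - xi_t n) * (b : xi_ring n))).
  rewrite raddfD !mulrBl !mul1r raddfB !pt.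
  by rewrite -[RHS]/(z * p a + (1 - z) * p b) mulrBl mul1r.
have s_hom : @quandle_hom (field_quandle z_unit) (xi_quandle n) s.
  move=> a b.
  rewrite -[LHS]/(s (z * (a : k) + (1 - z) * (b : k))).
  rewrite raddfD !mulrBl !mul1r raddfB ![s (z * _)]trace_section_scale //.
  by rewrite -[RHS]/(xi_t n * s a + (1 - xi_t n) * s b) mulrBl mul1r.
exact: cohomology_neq0 (essential_cocycle_retract p_hom s_hom sK sK phi_ess).
Qed.
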